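(* Let $(X,d)$ be a complete metric space and let $f:X\longrightarrow\mathbb{R}\cup\{+\infty\}$ be a proper function which is lower semicontinuous on $X$ and bounded from below. If there exists $\tau>0$ such that $$|\nabla f|(x)\in[\tau,+\infty)\quad\text{for every } x\in X\backslash\mathrm{Argmin}(f),$$ then $f$ admits global weak sharp minimizers and $\mathrm{wsha}(f)\ge\tau$.
   Context: Proper means that $f$ is finite at at least one point; $\mathrm{dom}(f)$ is the set of points at which $f$ is finite. Put $\underline{\alpha}=\inf_{x\in X}f(x)$ and let $\mathrm{Argmin}(f)=\{x\in X: f(x)\le\underline{\alpha}\}$ be the (possibly empty) set of global minimizers. For $A\subseteq X$, $\mathrm{dist}(x,A)=\inf_{a\in A}d(x,a)$, with $\mathrm{dist}(x,\varnothing)=+\infty$. The strong slope of $f$ at $\bar x\in\mathrm{dom}(f)$ is $|\nabla f|(\bar x)=0$ if $\bar x$ is a local minimizer of $f$, and $$|\nabla f|(\bar x)=\limsup_{x\to\bar x}\frac{f(\bar x)-f(x)}{d(x,\bar x)}$$ otherwise. If $\bar x\notin\mathrm{dom}(f)$, set $|\nabla f|(\bar x)=+\infty$. The function $f$ is said to have (admit) global weak sharp minimizers if $\mathrm{Argmin}(f)\ne\varnothing$ and there exists $\sigma>0$ such that $\sigma\cdot\mathrm{dist}(x,\mathrm{Argmin}(f))\le f(x)-\underline{\alpha}$ for every $x\in X$. The supremum of all such $\sigma$ is called the modulus of global weak sharpness of $f$ and is denoted by $\mathrm{wsha}(f)$. *)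

(* Defs.v *)
From mathcomp Require Import all_boot all_order all_algebra.
From mathcomp Require Import all_classical all_reals all_analysis.

Set Implicit Arguments.
Unset Strict Implicit.
Unset Printing Implicit Defensive.

Import Order.TTheory GRing.Theory Num.Theory.
Import numFieldNormedType.Exports.

Local Open Scope classical_set_scope.
Local Open Scope ring_scope.
Local Open Scope ereal_scope.

(* The library's [completeType] carries a distinguished point; here a metric
   space is not assumed to be pointed, or even nonempty. *)
Definition complete_metric (R : realType) (X : metricType R) : Prop :=
  forall u : nat -> X, cauchy (u @ \oo) -> exists l : X, u @ \oo --> l.

Section WeakSharpMinimizers.
Context {R : realType} {X : metricType R}.
Implicit Types (f : X -> \bar R) (x : X) (A : set X) (sigma : R).

(* Functions X -> R \cup {+oo} are the f : X -> \bar R that avoid -oo. *)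
Definition no_ninfty f : Prop := forall x, f x != -oo.

Definition dom_fun f : set X := [set x | f x \is a fin_num].

Definition proper_function f : Prop := dom_fun f !=set0.

Definition bounded_below f : Prop := exists m : R, forall x, m%:E <= f x.

Definition infval f : \bar R := ereal_inf (range f).

Definition Argmin f : set X := [set x | f x <= infval f].

(* [ereal_inf set0] is +oo, so the distance to the empty set is +oo. *)
Definition dist_set x A : \bar R := ereal_inf [set (mdist x a)%:E | a in A].

Definition local_minimizer f x : Prop := \forall y \near x, f x <= f y.

(* The limit superior is over punctured neighbourhoods [x^'], which are all
   nonempty when x is not a local minimizer; mdist y x > 0 on them. *)
Definition strong_slope f x : \bar R :=
  if x \in dom_fun f then
    if `[< local_minimizer f x >] then 0
    else limf_esup (fun y => (f x - f y) * ((mdist y x)^-1)%:E) x^'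
  else +oo.

Definition weak_sharpness_constant f sigma : Prop :=
  (0 < sigma)%R /\
  forall x, sigma%:E * dist_set x (Argmin f) <= f x - infval f.

Definition has_global_weak_sharp_minimizers f : Prop :=
  Argmin f !=set0 /\ exists sigma, weak_sharpness_constant f sigma.

(* The supremum is taken in \bar R: it is +oo when f is constant. *)
Definition wsha f : \bar R :=
  ereal_sup [set sigma%:E | sigma in weak_sharpness_constant f].

End WeakSharpMinimizers.

(* Main.v *)
Require Import Defs.
From mathcomp Require Import all_boot all_order all_algebra.
From mathcomp Require Import all_classical all_reals all_analysis.
From mathcomp Require Import lra.

(** The proof is a descent argument of Ekeland-Caristi type.  Fix
    [0 < sigma < tau] and say that [y] is reachable from [x] when the values
    drop between them at rate at least [sigma], that is
    [sigma * d(x, y) <= g x - g y].  This is a preorder, and lower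
    semicontinuity makes the set of points reachable from [x] closed.  In a
    complete space, with [g] bounded below, every point reaches a point [z] from
    which nothing but [z] itself is reachable ([ekeland_principle]).

    A point outside the set of minimizers is never such a dead end: its slope
    exceeds [sigma], so some nearby point is lower at a rate above [sigma]
    ([slope_gt_descent]).  Hence every [x] reaches a global minimizer [z], and
    the relation between [x] and [z] reads
    [sigma * dist(x, Argmin) <= sigma * d(x, z) <= g x - inf g].  Thus every
    [sigma] in the open interval from [0] to [tau] is a constant of weak
    sharpness, and the modulus is at least [tau].

    The argument takes place among real-valued functions: the value [+oo] has
    infinite slope, which the hypothesis forbids outside the minimizers, and the
    minimizers of a proper function have finite value. *)

Import Order.TTheory GRing.Theory Num.Theory.
Import numFieldNormedType.Exports.

Local Open Scope classical_set_scope.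
Local Open Scope ring_scope.

Section Descent.
Context {R : realType} {X : metricType R}.
Implicit Types (g : X -> R) (sigma : R) (x y z : X).

Definition descent sigma g x y : Prop := sigma * mdist x y <= g x - g y.

Lemma descent_refl sigma g x : descent sigma g x x.
Proof. by rewrite /descent mdistxx mulr0 subrr. Qed.

Lemma descent_trans sigma g y x z : 0 < sigma ->
  descent sigma g x y -> descent sigma g y z -> descent sigma g x z.
Proof.
move=> s0 xy yz; rewrite /descent.
have tri : sigma * mdist x z <= sigma * (mdist x y + mdist y z).
  by rewrite ler_pM2l// metric_triangle.
by move: xy yz tri; rewrite /descent mulrDr; lra.
Qed.

Lemma descent_le sigma g x y : 0 < sigma -> descent sigma g x y -> g y <= g x.
Proof.
move=> s0; rewrite /descent => xy.
have : 0 <= sigma * mdist x y by rewrite mulr_ge0 ?mdist_ge0// ltW.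
by move: xy; lra.
Qed.

(** If [z] were not reachable from [x], then by lower semicontinuity and the
    triangle inequality no point close enough to [z] would be. *)
Lemma descent_closed sigma g x z : 0 < sigma ->
  lower_semicontinuous (EFin \o g) ->
  closure (descent sigma g x) z -> descent sigma g x z.
Proof.
move=> s0 lsc clz; rewrite /descent leNgt; apply/negP => gap.
(* Half of [delta] is granted to [g] and half to the distance. *)
pose delta := (g z - g x + sigma * mdist x z) / 2.
have delta0 : 0 < delta by rewrite /delta; lra.
have [|V Vz gV] := lsc z (g z - delta); first by rewrite /= lte_fin; lra.
have Bz : nbhs z (ball z (delta / sigma)).
  by apply: nbhsx_ballx; rewrite divr_gt0.
have [y [xy [Vy]]] := clz _ (filterI Vz Bz).
rewrite -metricType_numDomainType.ball_mdistE/= => zy.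
move: (gV _ Vy); rewrite /= lte_fin => gy.
have szy : sigma * mdist z y < delta by rewrite mulrC -ltr_pdivlMr.
have tri : sigma * mdist x z <= sigma * (mdist x y + mdist y z).
  by rewrite ler_pM2l// metric_triangle.
move: xy tri szy gy; rewrite /descent mulrDr (metric_sym y z) /delta.
by lra.
Qed.

(** A sequence whose distances are controlled by the decrease of a bounded below
    real sequence has finite length. *)
Lemma cauchy_of_decrease (u : nat -> X) (v : nat -> R) :
  (forall n m, (n <= m)%N -> mdist (u n) (u m) <= v n - v m) ->
  has_lbound (range v) -> cauchy (u @ \oo).
Proof.
move=> uv vlb; apply: cauchy_exP => e e0.
have vinf : has_inf (range v) by split => //; exists (v 0%N), 0%N.
have [_ [N _ <-] vN] := inf_adherent e0 vinf.
exists (u N), N => // n /= Nn.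
rewrite -metricType_numDomainType.ball_mdistE/=.
apply: (le_lt_trans (uv _ _ Nn)).
have : inf (range v) <= v n by apply: ge_inf => //; exists n.
by move: vN; lra.
Qed.

(** The set of reachable values has an infimum; half of the possible decrease
    towards it is attained. *)
Lemma descent_half sigma g x : has_lbound (range g) ->
  exists y, descent sigma g x y /\
    forall w, descent sigma g x w -> 2 * g y <= g x + g w.
Proof.
move=> [m mg]; pose A := g @` descent sigma g x.
have Alb : has_lbound A by exists m => _ [w _ <-]; apply: mg; exists w.
have Aw w : descent sigma g x w -> inf A <= g w.
  by move=> xw; apply: ge_inf => //; exists w.
have [gx|gx] := leP (g x) (inf A).
  exists x; split; first exact: descent_refl.
  by move=> w /Aw; lra.
have [||_ [y xy <-] gy] := @inf_lt _ A ((inf A + g x) / 2).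
- by exists (g x), x => //; exact: descent_refl.
- by lra.
- by exists y; split => // w /Aw; lra.
Qed.

(** Along a sequence that each time attains half of the possible decrease, the
    values tend to a number not above the value of any point reachable from all
    terms; hence nothing below the limit point remains reachable. *)
Lemma ekeland_principle sigma g x : complete_metric X -> 0 < sigma ->
  lower_semicontinuous (EFin \o g) -> has_lbound (range g) ->
  exists2 z, descent sigma g x z & forall y, descent sigma g z y -> y = z.
Proof.
move=> cX s0 lsc glb.
have /choice[next nextP] := fun w => descent_half sigma g w glb.
pose u n := iter n next x.
have uD n m : (n <= m)%N -> descent sigma g (u n) (u m).
  move=> /subnK <-; elim: (m - n)%N => [|k IH]; first exact: descent_refl.
  exact: (descent_trans _ _ _ _ _ s0 IH (proj1 (nextP _))).
have gulb : has_lbound (range (g \o u)).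
  by case: glb => m mg; exists m => _ [n _ <-]; apply: mg; exists (u n).
have [z uz] : exists z, u @ \oo --> z.
  apply: cX; apply: (@cauchy_of_decrease _ (fun n => g (u n) / sigma)).
    by move=> n m /uD; rewrite /descent -mulrBl ler_pdivlMr// mulrC.
  case: gulb => m mg; exists (m / sigma) => _ [n _ <-].
  by rewrite ler_pM2r ?invr_gt0//; apply: mg; exists n.
have uDz n : descent sigma g (u n) z.
  apply: descent_closed => // V /uz[N _ NV].
  exists (u (maxn n N)); split; first by apply: uD; exact: leq_maxl.
  by apply: NV; exact: leq_maxr.
exists z; first exact: uDz 0%N.
move=> y zy; set L := inf (range (g \o u)).
have gzL : g z <= L.
  apply: lb_le_inf; first by exists (g (u 0%N)), 0%N.
  by move=> _ [n _ <-]; exact: descent_le _ _ _ _ s0 (uDz n).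
have Lgy : L <= g y.
  suff : 2 * L - g y <= L by lra.
  apply: lb_le_inf; first by exists (g (u 0%N)), 0%N.
  move=> _ [n _ <-] /=.
  have := (nextP (u n)).2 y (descent_trans _ _ _ _ _ s0 (uDz n) zy).
  have : L <= g (u n.+1) by apply: ge_inf => //; exists n.+1.
  by rewrite /=; lra.
apply/esym/mdist_positivity/eqP; rewrite eq_le mdist_ge0 andbT.
by rewrite -(pmulr_rle0 _ s0); move: zy gzL Lgy; rewrite /descent; lra.
Qed.

(** A limit superior over punctured neighbourhoods is at most the supremum over
    the whole complement of the point, so a difference quotient exceeds [sigma].
    The case of a local minimizer is void: its slope is zero. *)
Lemma slope_gt_descent sigma g x : 0 <= sigma ->
  (sigma%:E < strong_slope (EFin \o g) x)%E ->
  exists2 y, y != x & descent sigma g x y.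
Proof.
move=> s0; rewrite /strong_slope mem_set//.
case: ifP => _; first by rewrite lte_fin ltNge s0.
move=> slope.
have xV : x^' [set y | y != x] by apply/nbhs_dnbhs_neq.
have := lt_le_trans slope (ereal_inf_lbound (imageP _ xV)).
move=> /ereal_sup_gt[_ [y yx <-]] /=.
rewrite -EFinB -EFinM lte_fin ltr_pdivlMr ?mdist_gt0// => /ltW sy.
by exists y => //; rewrite /descent metric_sym.
Qed.

Lemma descent_to_Argmin sigma g x : complete_metric X -> 0 < sigma ->
  lower_semicontinuous (EFin \o g) -> has_lbound (range g) ->
  (forall w, w \notin Argmin (EFin \o g) ->
    (sigma%:E < strong_slope (EFin \o g) w)%E) ->
  exists2 z, Argmin (EFin \o g) z & descent sigma g x z.
Proof.
move=> cX s0 lsc glb slope.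
have [z xz zmin] := ekeland_principle _ _ x cX s0 lsc glb.
exists z => //; apply/set_mem; apply: contraT => /slope.
by move=> /(slope_gt_descent _ _ _ (ltW s0))[y /eqP yz /zmin].
Qed.

End Descent.

Local Open Scope ereal_scope.

Lemma infval_Argmin (R : realType) (X : metricType R) (f : X -> \bar R) z :
  Argmin f z -> infval f = f z.
Proof.
by move=> fz; apply/eqP; rewrite eq_le fz andbT; apply: ereal_inf_lbound; exists z.
Qed.

Lemma slope_finite_fin_num (R : realType) (X : metricType R) (f : X -> \bar R) :
  no_ninfty f -> proper_function f ->
  (forall x, x \notin Argmin f -> strong_slope f x < +oo) ->
  forall x, f x \is a fin_num.
Proof.
move=> fN [x0 fx0] slope x.
have [/set_mem fx|/slope] := boolP (x \in Argmin f); last first.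
  rewrite /strong_slope; case: ifPn => [/set_mem//|_].
  by rewrite ltxx.
rewrite fin_numElt ltNye fN/=; apply: le_lt_trans fx _.
apply: (@le_lt_trans _ _ (f x0)); first by apply: ereal_inf_lbound; exists x0.
by move: fx0; rewrite /dom_fun /= fin_numElt => /andP[].
Qed.

Lemma weak_sharpness_below_slope (R : realType) (X : metricType R) (g : X -> R)
    (sigma : R) : complete_metric X -> (0 < sigma)%R ->
  lower_semicontinuous (EFin \o g) -> has_lbound (range g) ->
  (forall w, w \notin Argmin (EFin \o g) ->
    sigma%:E < strong_slope (EFin \o g) w) ->
  weak_sharpness_constant (EFin \o g) sigma.
Proof.
move=> cX s0 lsc glb slope; split => // x.
have [z Az xz] := descent_to_Argmin _ _ x cX s0 lsc glb slope.
rewrite (infval_Argmin _ _ _ _ Az) /= -EFinB.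
apply: (@le_trans _ _ (sigma%:E * (mdist x z)%:E)); last by rewrite -EFinM lee_fin.
by rewrite lee_pmul2l ?lte_fin//; apply: ereal_inf_lbound; exists z.
Qed.

Theorem theorem2p4 (R : realType) (X : metricType R) (f : X -> \bar R)
    (tau : R) :
  complete_metric X ->
  no_ninfty f ->
  proper_function f ->
  lower_semicontinuous f ->
  bounded_below f ->
  (0 < tau)%R ->
  (forall x : X, x \notin Argmin f ->
     tau%:E <= strong_slope f x /\ strong_slope f x < +oo) ->
  has_global_weak_sharp_minimizers f /\ tau%:E <= wsha f.
Proof.
move=> cX fN fP lsc [m mf] tau0 slope.
have ffin := slope_finite_fin_num _ _ _ fN fP (fun x xA => (slope x xA).2).
have [x0 _] := fP.
have [g fg] : exists g : X -> R, f = EFin \o g.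
  by exists (fine \o f); apply/funext => x /=; rewrite fineK.
subst f.
have glb : has_lbound (range g).
  by exists m => _ [x _ <-]; have := mf x; rewrite lee_fin.
have slope_gt sigma : (sigma < tau)%R -> forall w, w \notin Argmin (EFin \o g) ->
    sigma%:E < strong_slope (EFin \o g) w.
  by move=> st w /slope[tw _]; apply: lt_le_trans tw; rewrite lte_fin.
have sharp sigma : (0 < sigma)%R -> (sigma < tau)%R ->
    weak_sharpness_constant (EFin \o g) sigma.
  by move=> s0 /slope_gt; exact: weak_sharpness_below_slope.
have half0 : (0 < tau / 2)%R by lra.
have half_lt : (tau / 2 < tau)%R by lra.
split.
  split; last by exists (tau / 2)%R; exact: sharp.
  have [z Az _] := descent_to_Argmin _ _ x0 cX half0 lsc glb (slope_gt _ half_lt).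
  by exists z.
apply/lee_subgt0Pr => e e0; rewrite -EFinB.
(* The bound [tau - e] may be nonpositive, hence the maximum with [tau / 2]. *)
apply: (@le_trans _ _ (Num.max (tau - e) (tau / 2))%:E).
  by rewrite lee_fin le_max lexx.
apply: ereal_sup_ubound; exists (Num.max (tau - e) (tau / 2))%R => //.
apply: sharp; first by rewrite lt_max half0 orbT.
by rewrite gt_max half_lt andbT; lra.
Qed.
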